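(* Let $H:\mathbb{R}^3\to\mathbb{R}^3$ be the map \[ H(x,y,z) = (1.76 - y^2 - 0.1 z,\ x,\ y), \] and let $f = H^4$ be its fourth iterate. Let $B=[-1,1]^3=\overline{\mathbb{B}_2}\times\overline{\mathbb{B}_1}$ and define the affine homeomorphisms $C_a, C_b:\mathbb{R}^3\to\mathbb{R}^3$ by \[ C_a^{-1}(v) = \begin{bmatrix} 0.81 \\ 1.0225 \\ 0.975 \end{bmatrix} + \begin{bmatrix} 0 & 0.19 & -0.03 \\ 0.1825 & 0 & 0 \\ 0 & -0.095 & -0.06 \end{bmatrix} v, \qquad C_b^{-1}(v) = \begin{bmatrix} 0.81 \\ 1.4875 \\ 0.975 \end{bmatrix} + \begin{bmatrix} 0 & 0.19 & -0.03 \\ 0.1225 & 0 & 0 \\ 0 & -0.095 & -0.06 \end{bmatrix} v . \] Let $N_a=(a,2,1,C_a)$ and $N_b=(b,2,1,C_b)$ be the h-sets with supports $a=C_a^{-1}(B)$ and $b=C_b^{-1}(B)$, exit dimension $2$ and entry dimension $1$. Then the covering relations \[ N_a \overset{H^4}{\Longrightarrow} N_a,\qquad N_a \overset{H^4}{\Longrightarrow} N_b,\qquad N_b \overset{H^4}{\Longrightarrow} N_b,\qquad N_b \overset{H^4}{\Longrightarrow} N_a \] all hold. Consequently $H^4$ has symbolic dynamics: with $I=\operatorname{Inv}_{H^4}(a\cup b)$ the invariant part of $a\cup b$ under $H^4$, the map $g:I\to\Sigma_2$ given by $g(x)_k = 0$ if $H^{4k}(x)\in a$ and $g(x)_k=1$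 if $H^{4k}(x)\in b$ ($k\in\mathbb{Z}$) is a continuous surjection satisfying $g\circ H^4|_I = \sigma\circ g$.
   Context: Notation: $\mathbb{B}_k=\{x\in\mathbb{R}^k:\|x\|_\infty<1\}$ is the open unit cube in $\mathbb{R}^k$. An h-set in $\mathbb{R}^n$ is a quadruple $N=(|N|,u(N),s(N),C_N)$ where $|N|\subset\mathbb{R}^n$ is compact, $u(N),s(N)\ge 0$ are integers with $u(N)+s(N)=n$, and $C_N:\mathbb{R}^n\to\mathbb{R}^{u(N)}\times\mathbb{R}^{s(N)}$ is a homeomorphism with $C_N(|N|)=N_c:=\overline{\mathbb{B}_{u(N)}}\times\overline{\mathbb{B}_{s(N)}}$. Write $N_c^-=\partial\mathbb{B}_{u(N)}\times\overline{\mathbb{B}_{s(N)}}$ (exit set) and $N_c^+=\overline{\mathbb{B}_{u(N)}}\times\partial\mathbb{B}_{s(N)}$ (entry set). Covering relation: for h-sets $M,N$ with $u(M)=u(N)=u$, $s(M)=s(N)=s$ and a continuous map $f:|M|\to\mathbb{R}^n$, put $f_c=C_N\circ f\circ C_M^{-1}:M_c\to\mathbb{R}^u\times\mathbb{R}^s$. We say $M$ $f$-covers $N$, written $M\overset{f}{\Longrightarrow}N$, if there is a continuous homotopy $h:[0,1]\times M_c\to\mathbb{R}^u\times\mathbb{R}^s$ with (1) $h_0=f_c$; (2) $h([0,1],M_c^-)\cap N_c=\varnothing$; (3) $h([0,1],M_c)\cap N_c^+=\varnothing$; (4) if $u>0$, there is a linear map $A:\mathbb{R}^u\to\mathbb{R}^u$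 with $h_1(x,y)=(A(x),0)$ for all $x\in\overline{\mathbb{B}_u}$, $y\in\overline{\mathbb{B}_s}$, and $A(\partial\mathbb{B}_u)\subset\mathbb{R}^u\setminus\mathbb{B}_u$. Symbolic dynamics: $\Sigma_2=\{0,1\}^{\mathbb{Z}}$ with the metric $\operatorname{dist}(l,l')=\sum_{n\in\mathbb{Z}}|l_n-l'_n|/2^{|n|}$ (product topology), and $\sigma:\Sigma_2\to\Sigma_2$ is the shift $(\sigma(l))_n=l_{n+1}$. The invariant part of a set $M$ under a homeomorphism $F$ is $\operatorname{Inv}_F(M)=\{x\in M: F^n(x)\in M \text{ for all } n\in\mathbb{Z}\}$. *)

(* Defs.v *)
From HB Require Import structures.
From mathcomp Require Import all_boot all_order all_algebra.
From mathcomp Require Import all_classical all_reals all_analysis.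
Unset Printing Implicit Defensive.
Import Order.TTheory GRing.Theory Num.Theory.
Import numFieldNormedType.Exports.
Local Open Scope classical_set_scope.
Local Open Scope ring_scope.

Section General.
Variable R : realType.

(* Points of R^k are row vectors 'rV[R]_k; `|x| is the max (sup) norm,
   so the open unit cube B_k is [set x | `|x| < 1]. *)

Definition cube (u s : nat) : set ('rV[R]_u * 'rV[R]_s) :=
  [set p | `|p.1| <= 1 /\ `|p.2| <= 1].
Definition cube_exit (u s : nat) : set ('rV[R]_u * 'rV[R]_s) :=
  [set p | `|p.1| = 1 /\ `|p.2| <= 1].
Definition cube_entry (u s : nat) : set ('rV[R]_u * 'rV[R]_s) :=
  [set p | `|p.1| <= 1 /\ `|p.2| = 1].

Definition is_hset (n u s : nat) (supp : set 'rV[R]_n)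
  (C : 'rV[R]_n -> 'rV[R]_u * 'rV[R]_s) (Ci : 'rV[R]_u * 'rV[R]_s -> 'rV[R]_n) : Prop :=
  compact supp /\ (u + s)%N = n /\
  continuous C /\ continuous Ci /\ cancel C Ci /\ cancel Ci C /\
  C @` supp = cube u s.

(* Covering relation M =f=> N, where CMi = C_M^{-1} and CN = C_N
   (both h-sets having exit dimension u and entry dimension s). *)
Definition covers (n u s : nat) (CMi : 'rV[R]_u * 'rV[R]_s -> 'rV[R]_n)
  (CN : 'rV[R]_n -> 'rV[R]_u * 'rV[R]_s) (f : 'rV[R]_n -> 'rV[R]_n) : Prop :=
  exists h : R -> 'rV[R]_u * 'rV[R]_s -> 'rV[R]_u * 'rV[R]_s,
    {within [set tp : R * ('rV[R]_u * 'rV[R]_s) | 0 <= tp.1 <= 1 /\ cube u s tp.2],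
       continuous (fun tp => h tp.1 tp.2)} /\
    (forall p, cube u s p -> h 0 p = CN (f (CMi p))) /\
    (forall (t : R) p, 0 <= t <= 1 -> cube_exit u s p -> ~ cube u s (h t p)) /\
    (forall (t : R) p, 0 <= t <= 1 -> cube u s p -> ~ cube_entry u s (h t p)) /\
    ((0 < u)%N -> exists A : 'M[R]_u,
        (forall (x : 'rV[R]_u) (y : 'rV[R]_s), `|x| <= 1 -> `|y| <= 1 -> h 1 (x, y) = (x *m A, 0)) /\
        (forall x : 'rV[R]_u, `|x| = 1 -> ~ `|x *m A| < 1)).

(* Symbolic dynamics: Sigma_2 = {0,1}^Z, with 0 ~ false and 1 ~ true. *)
Definition Sigma2 := int -> bool.
Definition sigma_shift (l : Sigma2) : Sigma2 := fun n => l (n + 1).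
Definition Sdist (l l' : Sigma2) : \bar R :=
  \esum_(n in [set: int]) (((l n != l' n)%:R / 2 ^+ `|n|%N : R)%:E).

Definition zpow {T : Type} (F Finv : T -> T) (k : int) : T -> T :=
  match k with Posz m => iter m F | Negz m => iter m.+1 Finv end.

Definition Inv {T : Type} (F Finv : T -> T) (M : set T) : set T :=
  [set x | M x /\ forall k : int, M (zpow F Finv k x)].

Definition vec3 (L : seq R) : 'rV[R]_3 := \row_(j < 3) nth 0 L j.
Definition mat3 (L : seq (seq R)) : 'M[R]_3 := \matrix_(i < 3, j < 3) nth 0 (nth [::] L i) j.
Definition crd (v : 'rV[R]_3) (k : nat) : R := v ord0 (inord k).
Definition dec (p q : nat) : R := p%:R / q%:R.

End General.
Arguments cube {R} u s _.
Arguments cube_exit {R} u s _.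
Arguments cube_entry {R} u s _.
Arguments is_hset {R} n u s supp C Ci.
Arguments covers {R} n u s CMi CN f.
Arguments Sdist {R} l l'.
Arguments vec3 {R} L.
Arguments mat3 {R} L.
Arguments crd {R} v k.
Arguments dec {R} p q.

Section Henon.
Variable R : realType.

Definition Hmap (v : 'rV[R]_3) : 'rV[R]_3 :=
  vec3 [:: dec 176 100 - crd v 1 ^+ 2 - dec 1 10 * crd v 2; crd v 0; crd v 1].
Definition Hinv (v : 'rV[R]_3) : 'rV[R]_3 :=
  vec3 [:: crd v 1; crd v 2; (dec 176 100 - crd v 2 ^+ 2 - crd v 0) / dec 1 10].

Definition H4 : 'rV[R]_3 -> 'rV[R]_3 := iter 4 Hmap.
Definition H4pow (k : int) : 'rV[R]_3 -> 'rV[R]_3 := zpow Hmap Hinv (4 * k).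

Definition Ma : 'M[R]_3 := mat3
  [:: [:: 0; dec 19 100; - dec 3 100];
      [:: dec 73 400 (* 0.1825 *); 0; 0];
      [:: 0; - dec 19 200 (* 0.095 *); - dec 6 100]].
Definition Mb : 'M[R]_3 := mat3
  [:: [:: 0; dec 19 100; - dec 3 100];
      [:: dec 49 400 (* 0.1225 *); 0; 0];
      [:: 0; - dec 19 200 (* 0.095 *); - dec 6 100]].
Definition ca : 'rV[R]_3 := vec3 [:: dec 81 100; dec 409 400 (* 1.0225 *); dec 39 40 (* 0.975 *)].
Definition cb : 'rV[R]_3 := vec3 [:: dec 81 100; dec 119 80 (* 1.4875 *); dec 39 40 (* 0.975 *)].

(* C^{-1}(v) = c + M v (column convention), v = (x, y) in R^2 x R^1 *)
Definition affinv (c : 'rV[R]_3) (M : 'M[R]_3) (p : 'rV[R]_2 * 'rV[R]_1) : 'rV[R]_3 :=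
  c + (row_mx p.1 p.2 : 'rV[R]_(2 + 1)) *m M^T.
Definition aff (c : 'rV[R]_3) (M : 'M[R]_3) (w : 'rV[R]_3) : 'rV[R]_2 * 'rV[R]_1 :=
  let v : 'rV[R]_(2 + 1) := (w - c) *m (invmx M)^T in (lsubmx v, rsubmx v).

Definition Cainv := affinv ca Ma.
Definition Ca := aff ca Ma.
Definition Cbinv := affinv cb Mb.
Definition Cb := aff cb Mb.

Definition aset : set 'rV[R]_3 := Cainv @` cube 2 1.
Definition bset : set 'rV[R]_3 := Cbinv @` cube 2 1.

Definition Iset : set 'rV[R]_3 := Inv H4 (iter 4 Hinv) (aset `|` bset).

Definition gmap (x : 'rV[R]_3) : Sigma2 := fun k => ~~ `[< aset (H4pow k x) >].

End Henon.
Arguments Hmap {R} v.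
Arguments Hinv {R} v.
Arguments H4 {R} _.
Arguments H4pow {R} k _.
Arguments Ma {R}.
Arguments Mb {R}.
Arguments ca {R}.
Arguments cb {R}.
Arguments affinv {R} c M p.
Arguments aff {R} c M w.
Arguments Cainv {R} _.
Arguments Cbinv {R} _.
Arguments Ca {R} _.
Arguments Cb {R} _.
Arguments aset {R} _.
Arguments bset {R} _.
Arguments Iset {R} _.
Arguments gmap {R} x _.

(* Main.v *)
Require Import Defs.
From HB Require Import structures.
From mathcomp Require Import all_boot all_order all_algebra.
From mathcomp Require Import all_classical all_reals all_analysis.
From mathcomp Require Import ring lra.
Import Order.TTheory GRing.Theory Num.Theory.
Import numFieldNormedType.Exports.
Local Open Scope classical_set_scope.
Local Open Scope ring_scope.

(* An orbit of [H] is a sequence with t_(n+1) = 1.76 - t_(n-1)^2 - 0.1 t_(n-2), so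
   that H^4 (x, y, z) = (x4, x3, x2), where x1 and x3 are governed by y, while x2
   and x4 are governed by x. In the frames of a and b the first unstable
   coordinate is stretched across both sets along y -> x1 -> x3, the second one is
   stretched along x -> x2 -> x4, and the stable coordinate of the image is small
   wherever the second unstable one is. These estimates make the map homotopic to
   diag (+-2, 2), which gives the covering relations.

   For surjectivity no degree theory is needed: solving the recursion backwards,
   t_(n-1) = +- sqrt (1.76 - t_(n+1) - 0.1 t_(n-2)), where the sign of x1 is
   prescribed by the itinerary and the other terms are positive, is a contraction
   on suitable bi-infinite sequences. Its fixed point is the required orbit. *)

(** * Interval estimates for one return *)

Definition henon_step {R : realFieldType} (u v : R) : R :=
  176 / 100 - u ^+ 2 - 1 / 10 * v.

(** The [y]-ranges of [a] and [b] are [0.84, 1.205] and [1.365, 1.61]; the first four lemmas treat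
    their four edges. At the outer edges x1 is close to 0.95 or to -0.93, and a tangent line bounds
    its square from below. *)
Lemma henon_step2_left_a (R : realFieldType) (q r x z : R) :
  -1 <= q <= 1 -> -1 <= r <= 1 ->
  x = 81 / 100 + 19 / 100 * q - 3 / 100 * r ->
  z = 39 / 40 - 19 / 200 * q - 6 / 100 * r ->
  henon_step (henon_step (84 / 100) z) x < 84 / 100.
Proof.
move=> hq hr hx hz; rewrite {1}/henon_step.
have : henon_step (84 / 100) z = 9569/10000 + 95/10000 * q + 6/1000 * r.
  by rewrite /henon_step; lra.
by move: (henon_step _ _) => w hw; have := sqr_ge0 (w - 95 / 100); lra.
Qed.

Lemma henon_step2_right_b (R : realFieldType) (q r x z : R) :
  -1 <= q <= 1 -> -1 <= r <= 1 ->
  x = 81 / 100 + 19 / 100 * q - 3 / 100 * r ->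
  z = 39 / 40 - 19 / 200 * q - 6 / 100 * r ->
  henon_step (henon_step (161 / 100) z) x < 84 / 100.
Proof.
move=> hq hr hx hz; rewrite {1}/henon_step.
have : henon_step (161 / 100) z = - (9296/10000) + 95/10000 * q + 6/1000 * r.
  by rewrite /henon_step; lra.
by move: (henon_step _ _) => w hw; have := sqr_ge0 (w + 93 / 100); lra.
Qed.

Lemma henon_step2_right_a (R : realFieldType) (q r x z : R) :
  -1 <= q <= 1 -> -1 <= r <= 1 ->
  x = 81 / 100 + 19 / 100 * q - 3 / 100 * r ->
  z = 39 / 40 - 19 / 200 * q - 6 / 100 * r ->
  161 / 100 < henon_step (henon_step (1205 / 1000) z) x.
Proof.
move=> hq hr hx hz; rewrite {1}/henon_step.
have : henon_step (1205 / 1000) z = 21/100 + 475/1000/1000 + 95/10000 * q + 6/1000 * r.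
  by rewrite /henon_step; lra.
move: (henon_step _ _) => w hw.
(* At the inner edges the square of x1 has to be small: the chord over the range of [w] bounds it
   from above. *)
have : (w - 194/1000) * (226/1000 - w) >= 0 by apply: mulr_ge0; lra.
lra.
Qed.

Lemma henon_step2_left_b (R : realFieldType) (q r x z : R) :
  -1 <= q <= 1 -> -1 <= r <= 1 ->
  x = 81 / 100 + 19 / 100 * q - 3 / 100 * r ->
  z = 39 / 40 - 19 / 200 * q - 6 / 100 * r ->
  161 / 100 < henon_step (henon_step (1365 / 1000) z) x.
Proof.
move=> hq hr hx hz; rewrite {1}/henon_step.
have : henon_step (1365 / 1000) z = - (2/10 + 725/1000/1000) + 95/10000 * q + 6/1000 * r.
  by rewrite /henon_step; lra.
move: (henon_step _ _) => w hw.
have : (w + 217/1000) * (- 185/1000 - w) >= 0 by apply: mulr_ge0; lra.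
lra.
Qed.

Lemma henon_step_bounds (R : realFieldType) (q r y z : R) :
  -1 <= q <= 1 -> -1 <= r <= 1 ->
  z = 39 / 40 - 19 / 200 * q - 6 / 100 * r ->
  84 / 100 <= y <= 161 / 100 ->
  - (95 / 100) <= henon_step y z <= 98 / 100.
Proof.
move=> hq hr hz hy.
have h : (y - 84 / 100) * (161 / 100 - y) >= 0 by apply: mulr_ge0; lra.
have := sqr_ge0 (y - 84 / 100).
by rewrite /henon_step => h2; apply/andP; split; lra.
Qed.

(** By Cramer's rule the difference is 57/4000 times the second unstable coordinate of the image,
    57/4000 being the absolute determinant of the (x, z) block of the frame. The first coordinate is
    taken on the face q = 1; the next lemma takes q = -1. *)
Lemma exit_ucoord2_right (R : realFieldType) (r x1 x2 y : R) : -1 <= r <= 1 ->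
  - (95 / 100) <= x1 <= 98 / 100 -> 84 / 100 <= y <= 161 / 100 ->
  x2 = henon_step (1 - 3 / 100 * r) y ->
  57 / 4000 < 6 / 100 * (henon_step x2 x1 - 81 / 100) - 3 / 100 * (x2 - 39 / 40).
Proof.
rewrite /henon_step => hr h1 hy h2.
have {}h2 : 5 / 10 <= x2 <= 8 / 10 by rewrite h2; apply/andP; split; nra.
nra.
Qed.

Lemma exit_ucoord2_left (R : realFieldType) (r x1 x2 y : R) : -1 <= r <= 1 ->
  - (95 / 100) <= x1 <= 98 / 100 -> 84 / 100 <= y <= 161 / 100 ->
  x2 = henon_step (62 / 100 - 3 / 100 * r) y ->
  6 / 100 * (henon_step x2 x1 - 81 / 100) - 3 / 100 * (x2 - 39 / 40) < - (57 / 4000).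
Proof.
rewrite /henon_step => hr h1 hy h2.
have {}h2 : 115 / 100 <= x2 <= 135 / 100 by rewrite h2; apply/andP; split; nra.
nra.
Qed.

(** As a function of x2 near 0.975, x4 has slope -1.95, so the linear part of the second combination
    almost cancels: 0.19 - 0.095 * 1.95 = 0.00475. There remain small terms in [Z ^+ 2] and [x1] and
    a tiny constant. *)
Lemma scoord_bound (R : realFieldType) (x x1 x2 y : R) : 59 / 100 <= x <= 103 / 100 ->
  - (95 / 100) <= x1 <= 98 / 100 -> 84 / 100 <= y <= 161 / 100 ->
  x2 = henon_step x y ->
  let X := henon_step x2 x1 - 81 / 100 in let Z := x2 - 39 / 40 in
  - (57 / 4000) <= 6 / 100 * X - 3 / 100 * Z <= 57 / 4000 ->
  - (57 / 4000) < 19 / 100 * Z + 19 / 200 * X < 57 / 4000.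
Proof.
rewrite /henon_step => hx h1 hy h2.
have {}h2 : 5 / 10 <= x2 <= 135 / 100 by rewrite h2; apply/andP; split; nra.
have [Z hZ] : exists Z, x2 = Z + 39 / 40 by exists (x2 - 39 / 40); lra.
rewrite /= hZ => h.
(* The first combination has slope about -0.147 in [Z], so its bound confines [Z]. *)
have {}hZ : -15 / 100 <= Z <= 14 / 100 by apply/andP; split; nra.
have : (Z + 15 / 100) * (14 / 100 - Z) >= 0 by apply: mulr_ge0; lra.
have := sqr_ge0 Z.
by move=> *; apply/andP; split; lra.
Qed.

(** * Coordinates of the h-sets *)

Lemma rV_norm_leP (R : realType) n (v : 'rV[R]_n) (e : R) : 0 <= e ->
  `|v| <= e <-> forall i, `|v ord0 i| <= e.
Proof.
move=> e0; rewrite [`|v|]/Num.norm /= mx_normrE; split=> [/bigmax_leP[_ h] i|h].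
  exact: (h (ord0, i)).
by apply/bigmax_leP; split=> // -[i j] _; rewrite /= (ord1 i).
Qed.

(** A nonzero norm excludes n = 0, where the norm is 0 and no index exists. *)
Lemma rV_norm_attained (R : realType) n (v : 'rV[R]_n) : `|v| != 0 ->
  exists i, `|v| = `|v ord0 i|.
Proof.
by move=> /mx_norm_neq0[[i j]]; rewrite (ord1 i) => h; exists j; exact: h.
Qed.

Lemma crdE (R : realType) (s : seq R) k : (k < 3)%N -> crd (vec3 s) k = s`_k.
Proof. by move=> k3; rewrite /crd mxE inordK. Qed.

Lemma rV3P (R : realType) (u v : 'rV[R]_3) : crd u 0 = crd v 0 ->
  crd u 1 = crd v 1 -> crd u 2 = crd v 2 -> u = v.
Proof.
rewrite /crd => h0 h1 h2; apply/rowP => -[[|[|[|//]]] hi].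
- by rewrite (_ : Ordinal hi = inord 0) //; apply/val_inj; rewrite /= inordK.
- by rewrite (_ : Ordinal hi = inord 1) //; apply/val_inj; rewrite /= inordK.
- by rewrite (_ : Ordinal hi = inord 2) //; apply/val_inj; rewrite /= inordK.
Qed.

Section HSet.
Variables (R : realType).
Implicit Types (cy w : R) (p : 'rV[R]_2 * 'rV[R]_1) (v : 'rV[R]_3).

(** The two h-sets differ only in the [y]-center [cy] and the [y]-half-width [w], so both are
    handled through [center] and [frame]. *)
Definition center cy : 'rV[R]_3 := vec3 [:: dec 81 100; cy; dec 39 40].
Definition frame w : 'M[R]_3 := mat3
  [:: [:: 0; dec 19 100; - dec 3 100];
      [:: w; 0; 0];
      [:: 0; - dec 19 200; - dec 6 100]].
(** The (x, z) block is inverted by Cramer's rule; its determinant is -57/4000. *)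
Definition frame_inv w : 'M[R]_3 := mat3
  [:: [:: 0; w^-1; 0];
      [:: 6 / 100 / (57 / 4000); 0; - (3 / 100 / (57 / 4000))];
      [:: - (19 / 200 / (57 / 4000)); 0; - (19 / 100 / (57 / 4000))]].

Lemma frame_mulV w : w != 0 -> frame w *m frame_inv w = 1%:M.
Proof.
move=> w0; apply/matrixP => -[[|[|[|//]]] hi] -[[|[|[|//]]] hj];
  rewrite !mxE !big_ord_recl big_ord0 !mxE /= /dec;
  rewrite ?mulr1n ?mulr0n ?mul0r ?mulr0 ?addr0 ?add0r ?divff //; lra.
Qed.

Lemma invmx_frame w : w != 0 -> invmx (frame w) = frame_inv w.
Proof.
move=> w0; have h := frame_mulV w w0; have [u _] := mulmx1_unit h.
by rewrite -[LHS]mulmx1 -h mulKmx.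
Qed.

Definition ucoord1 p : R := p.1 ord0 ord0.
Definition ucoord2 p : R := p.1 ord0 ord_max.
Definition scoord p : R := p.2 ord0 ord0.

Lemma affinvE cy w p : affinv (center cy) (frame w) p =
  vec3 [:: 81 / 100 + 19 / 100 * ucoord2 p - 3 / 100 * scoord p;
           cy + w * ucoord1 p;
           39 / 40 - 19 / 200 * ucoord2 p - 6 / 100 * scoord p].
Proof.
have hq : p.1 ord0 (lift ord0 ord0) = ucoord2 p by congr (_ _ _); exact: val_inj.
apply/rowP => -[[|[|[|//]]] hi];
  rewrite !mxE /= (@big_split_ord _ _ _ 2 1) /= !big_ord_recl !big_ord0;
  rewrite !row_mxEl !row_mxEr !mxE /= -?/(ucoord1 p) ?hq -?/(scoord p) /dec; ring.
Qed.

Lemma affE cy w v : w != 0 ->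
  [/\ ucoord1 (aff (center cy) (frame w) v) = (crd v 1 - cy) / w,
      ucoord2 (aff (center cy) (frame w) v) =
        (6 / 100 * (crd v 0 - 81 / 100) - 3 / 100 * (crd v 2 - 39 / 40)) / (57 / 4000) &
      scoord (aff (center cy) (frame w) v) =
        - (19 / 100 * (crd v 2 - 39 / 40) + 19 / 200 * (crd v 0 - 81 / 100)) / (57 / 4000)].
Proof.
move=> w0; rewrite /aff (invmx_frame _ w0) /ucoord1 /ucoord2 /scoord /= !mxE.
have c0 : v ord0 ord0 = crd v 0.
  by congr (v _ _); apply: val_inj; rewrite /= inordK.
have c1 : v ord0 (lift ord0 ord0) = crd v 1.
  by congr (v _ _); apply: val_inj; rewrite /= inordK.
have c2 : v ord0 (lift ord0 (lift ord0 ord0)) = crd v 2.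
  by congr (v _ _); apply: val_inj; rewrite /= inordK.
split; rewrite !big_ord_recl !big_ord0 !mxE /= c0 c1 c2 /dec; field => //.
Qed.

Lemma coord_ext (p p' : 'rV[R]_2 * 'rV[R]_1) :
  ucoord1 p = ucoord1 p' -> ucoord2 p = ucoord2 p' -> scoord p = scoord p' -> p = p'.
Proof.
case: p p' => [a b] [a' b']; rewrite /ucoord1 /ucoord2 /scoord /= => h1 h2 h3.
congr pair; apply/rowP => -[[|[|//]] hi] //.
- by rewrite (_ : Ordinal hi = ord0) //; apply/val_inj.
- by rewrite (_ : Ordinal hi = ord_max) //; apply/val_inj.
- by rewrite (_ : Ordinal hi = ord0) //; apply/val_inj.
Qed.

Lemma affinvK cy w : w != 0 -> cancel (affinv (center cy) (frame w)) (aff (center cy) (frame w)).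
Proof.
move=> w0 p; have [h1 h2 h3] := affE cy w (affinv (center cy) (frame w) p) w0.
by apply: coord_ext; rewrite ?h1 ?h2 ?h3 affinvE !crdE //=; field.
Qed.

Lemma affK cy w : w != 0 -> cancel (aff (center cy) (frame w)) (affinv (center cy) (frame w)).
Proof.
move=> w0 v; have [h1 h2 h3] := affE cy w v w0.
by apply: rV3P; rewrite affinvE !crdE //= ?h1 ?h2 ?h3; field.
Qed.

Lemma cube_coordP p : cube 2 1 p <->
  [/\ -1 <= ucoord1 p <= 1, -1 <= ucoord2 p <= 1 & -1 <= scoord p <= 1].
Proof.
rewrite /cube /= !rV_norm_leP // -!ler_norml; split.
  by move=> [h1 h2]; split; [exact: h1|exact: h1|exact: h2].
move=> [h1 h2 h3]; split => -[[|[|//]] hi] //.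
- by rewrite (_ : Ordinal hi = ord0) //; apply/val_inj.
- by rewrite (_ : Ordinal hi = ord_max) //; apply/val_inj.
- by rewrite (_ : Ordinal hi = ord0) //; apply/val_inj.
Qed.

End HSet.

(** * Covering relations *)

Lemma rV_continuous (R : realType) (T : topologicalType) n (f : T -> 'rV[R]_n) :
  (forall i, continuous (fun t => f t ord0 i)) -> continuous f.
Proof.
move=> h x A [P hP sPA].
have : \forall t \near x, forall i, P ord0 i (f t ord0 i).
  by apply: filter_forall => i; exact: (h i x _ (hP ord0 i)).
by apply: filterS => t ht; apply: sPA => i j; rewrite (ord1 i).
Qed.

Lemma vec3_continuous (R : realType) (T : topologicalType) (f g h : T -> R) :
  continuous f -> continuous g -> continuous h ->
  continuous (fun t => vec3 [:: f t; g t; h t]).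
Proof.
move=> cf cg ch; apply: rV_continuous => -[[|[|[|//]]] hi];
  by under eq_fun do rewrite mxE.
Qed.

Lemma pair_continuous (T U V : topologicalType) (f : T -> U) (g : T -> V) :
  continuous f -> continuous g -> continuous (fun x => (f x, g x)).
Proof. by move=> cf cg x; exact: (cvg_pair (cf x) (cg x)). Qed.

Lemma fst_continuous (T U V : topologicalType) (f : T -> U * V) :
  continuous f -> continuous (fun x => (f x).1).
Proof.
by move=> cf x; apply: (@continuous_comp _ _ _ f fst); [exact: cf|exact: cvg_fst].
Qed.

Lemma snd_continuous (T U V : topologicalType) (f : T -> U * V) :
  continuous f -> continuous (fun x => (f x).2).
Proof.
by move=> cf x; apply: (@continuous_comp _ _ _ f snd); [exact: cf|exact: cvg_snd].
Qed.

Lemma entry_continuous (R : realType) (T : topologicalType) n (f : T -> 'rV[R]_n) j :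
  continuous f -> continuous (fun x => f x ord0 j).
Proof.
move=> cf x; apply: (@continuous_comp _ _ _ f (fun M => M ord0 j)); first exact: cf.
exact: coord_continuous.
Qed.

(** On a face where the [j]-th unstable coordinate is 1 or -1, both [g] and the linear model
    [diag_mx (2 *: d)] push that coordinate beyond 1 on the same side, given by the sign [d ord0 j].
    Convex combinations of the two therefore stay outside the cube. *)
Lemma covers_diag (R : realType) n u s (CMi : 'rV[R]_u * 'rV[R]_s -> 'rV[R]_n)
    (CN : 'rV[R]_n -> 'rV[R]_u * 'rV[R]_s) f (d : 'rV[R]_u) :
  let g p := CN (f (CMi p)) in
  continuous g -> (forall j, `|d ord0 j| = 1) ->
  (forall p j, cube u s p -> `|p.1 ord0 j| = 1 ->
     1 < d ord0 j * p.1 ord0 j * (g p).1 ord0 j) ->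
  (forall p, cube u s p -> `|(g p).1| <= 1 -> `|(g p).2| < 1) ->
  covers n u s CMi CN f.
Proof.
move=> g cg d1 gexit gentry.
(* First the stable part is contracted to 0 ([al] goes from 1 to 0 on [0, 1/2]),
   which keeps the entry condition; then the unstable part is deformed linearly
   ([be] goes from 0 to 1 on [1/2, 1]). *)
pose al (t : R) : R := (`|1 - 2 * t| + (1 - 2 * t)) / 2.
pose be (t : R) : R := (`|1 - 2 * t| - (1 - 2 * t)) / 2.
pose A : 'M[R]_u := diag_mx (2 *: d).
have be01 t : 0 <= t <= 1 -> 0 <= be t <= 1.
  by move=> t01; rewrite /be; case: (ger0P (1 - 2 * t)) => h; lra.
have al01 t : 0 <= t <= 1 -> 0 <= al t <= 1.
  by move=> t01; rewrite /al; case: (ger0P (1 - 2 * t)) => h; lra.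
have albe t : be t = 0 \/ al t = 0.
  rewrite /be /al; case: (ger0P (1 - 2 * t)) => h; [left|right]; lra.
exists (fun t p => ((1 - be t) *: (g p).1 + be t *: (p.1 *m A), al t *: (g p).2)).
split; [|split; [|split; [|split]]].
- apply: continuous_subspaceT.
  have cn : continuous (fun tp : R * ('rV[R]_u * 'rV[R]_s) => 1 - 2 * tp.1).
    move=> x; apply: cvgB; first exact: cvg_cst.
    by apply: cvgM; [exact: cvg_cst|exact: cvg_fst].
  have cbe : continuous (fun tp : R * ('rV[R]_u * 'rV[R]_s) => be tp.1).
    rewrite /be => x; apply: cvgM; last exact: cvg_cst.
    by apply: cvgB; [exact: (cvg_norm (cn x))|exact: cn].
  have cal : continuous (fun tp : R * ('rV[R]_u * 'rV[R]_s) => al tp.1).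
    rewrite /al => x; apply: cvgM; last exact: cvg_cst.
    by apply: cvgD; [exact: (cvg_norm (cn x))|exact: cn].
  have cg2 : continuous (fun tp : R * ('rV[R]_u * 'rV[R]_s) => g tp.2).
    move=> x; apply: (@continuous_comp _ _ _ snd g); last exact: cg.
    exact: cvg_snd.
  have cg1 j : continuous (fun tp : R * ('rV[R]_u * 'rV[R]_s) => (g tp.2).1 ord0 j).
    exact/entry_continuous/fst_continuous.
  have cg3 j : continuous (fun tp : R * ('rV[R]_u * 'rV[R]_s) => (g tp.2).2 ord0 j).
    exact/entry_continuous/snd_continuous.
  have cx j : continuous (fun tp : R * ('rV[R]_u * 'rV[R]_s) => tp.2.1 ord0 j).
    by apply/entry_continuous/fst_continuous => x; exact: cvg_snd.
  apply: pair_continuous.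
  + apply: rV_continuous => i; under eq_fun do rewrite mul_mx_diag !mxE.
    move=> x; apply: cvgD; apply: cvgM.
    * by apply: cvgB; [exact: cvg_cst|exact: cbe].
    * exact: cg1.
    * exact: cbe.
    * by apply: cvgM; [exact: cx|exact: cvg_cst].
  + apply: rV_continuous => i; under eq_fun do rewrite !mxE.
    by move=> x; apply: cvgM; [exact: cal|exact: cg3].
- move=> p _; rewrite /al /be mulr0 subr0 normr1 subrr mul0r subr0 scale1r scale0r addr0.
  by rewrite divff ?scale1r -?surjective_pairing // pnatr_eq0.
- move=> t p t01 [p1 p2] [/= h1 _].
  have [|j hj] := rV_norm_attained _ _ p.1; first by rewrite p1 oner_neq0.
  have hp : cube u s p by split=> //; rewrite p1.
  have := gexit p j hp; rewrite -hj p1 => /(_ erefl) gj.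
  have := (rV_norm_leP _ _ _ 1 ler01).1 h1 j.
  rewrite mul_mx_diag !mxE => hh.
  have e1 : `|d ord0 j * p.1 ord0 j| = 1 by rewrite normrM d1 -hj p1 mulr1.
  have e2 : (d ord0 j * p.1 ord0 j) ^+ 2 = 1.
    by rewrite -real_normK ?num_real // e1 expr1n.
  set G := (g p).1 ord0 j in gj hh; set a := d ord0 j * p.1 ord0 j in gj e1 e2.
  (* Multiplying by [a], whose square is 1, turns the [j]-th coordinate of the homotopy into
     [(1 - be t) * (a * G) + 2 * be t], which exceeds 1. *)
  have : `|a * ((1 - be t) * G + be t * (p.1 ord0 j * (2 * d ord0 j)))| <= 1.
    by rewrite normrM e1 mul1r.
  rewrite ler_norml => /andP[_].
  have -> : a * ((1 - be t) * G + be t * (p.1 ord0 j * (2 * d ord0 j))) =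
      (1 - be t) * (a * G) + 2 * be t * a ^+ 2 by rewrite /a; ring.
  have b1 := be01 t t01; rewrite e2; move: (a * G) gj => z gj.
  have : 0 < (1 - be t) * (z - 1) + be t.
    (* Each summand can vanish at one end of the homotopy: the first is positive when [be t] is at
       most 1/2, the second when it is larger. *)
    have [hb|hb] := leP (be t) (1 / 2).
      by rewrite ltr_wpDr //; [lra|apply: mulr_gt0; lra].
    by rewrite ltr_wpDl //; [apply: mulr_ge0; lra|lra].
  lra.
- move=> t p t01 hp [/= h1 h2]; have a1 := al01 t t01.
  (* While [be t = 0] the unstable part is still that of [g], so [gentry] applies; otherwise the
     stable part is already 0. *)
  case: (albe t) => e.
    move: h1; rewrite e subr0 scale1r scale0r addr0 => /(gentry p hp) g2.
    have : (1 - al t) * `|(g p).2| >= 0 by apply: mulr_ge0; [lra|exact: normr_ge0].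
    move: h2; rewrite normrZ (ger0_norm (x := al t)); lra.
  by move: h2; rewrite e scale0r normr0; lra.
- move=> _; exists A; split=> [x y x1 y1 /=|x x1].
    have -> : be 1 = 1 by rewrite /be ler0_norm; lra.
    have -> : al 1 = 0 by rewrite /al ler0_norm; lra.
    by rewrite subrr !scale0r scale1r add0r.
  have [|j hj] := rV_norm_attained _ _ x; first by rewrite x1 oner_neq0.
  move=> /ltW /(rV_norm_leP _ _ _ 1 ler01) /(_ j).
  rewrite mul_mx_diag !mxE !normrM d1 -hj x1 normr_nat; lra.
Qed.

(** * Continuity and invertibility of the Hénon map *)

Section RealContinuity.
Variables (R : realType) (T : topologicalType).
Implicit Types f g : T -> R.

Lemma cst_fun_continuous (a : R) : continuous (fun _ : T => a).
Proof. by move=> x; exact: cvg_cst. Qed.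

Lemma add_fun_continuous f g :
  continuous f -> continuous g -> continuous (fun x => f x + g x).
Proof. by move=> cf cg x; exact: (continuousD (cf x) (cg x)). Qed.

Lemma sub_fun_continuous f g :
  continuous f -> continuous g -> continuous (fun x => f x - g x).
Proof. by move=> cf cg x; exact: (continuousB (cf x) (cg x)). Qed.

Lemma mul_fun_continuous f g :
  continuous f -> continuous g -> continuous (fun x => f x * g x).
Proof. by move=> cf cg x; exact: (continuousM (cf x) (cg x)). Qed.

Lemma henon_step_continuous f g :
  continuous f -> continuous g -> continuous (fun x => henon_step (f x) (g x)).
Proof.
move=> cf cg; rewrite /henon_step; under eq_fun do rewrite expr2.
apply: sub_fun_continuous; apply: sub_fun_continuous || apply: mul_fun_continuous => //.
- exact: cst_fun_continuous.
- exact: mul_fun_continuous.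
- exact: cst_fun_continuous.
Qed.

End RealContinuity.

Lemma crd_continuous (R : realType) k : continuous (fun v : 'rV[R]_3 => crd v k).
Proof. exact: coord_continuous. Qed.

Lemma Hmap_continuous (R : realType) : continuous (@Hmap R).
Proof.
apply: vec3_continuous; [|exact: crd_continuous|exact: crd_continuous].
by apply: henon_step_continuous; exact: crd_continuous.
Qed.

Lemma Hinv_continuous (R : realType) : continuous (@Hinv R).
Proof.
apply: vec3_continuous; [exact: crd_continuous|exact: crd_continuous|].
under eq_fun do rewrite expr2.
apply: mul_fun_continuous; last exact: cst_fun_continuous.
apply: sub_fun_continuous; last exact: crd_continuous.
apply: sub_fun_continuous; first exact: cst_fun_continuous.
by apply: mul_fun_continuous; exact: crd_continuous.
Qed.

Lemma iter_continuous (T : topologicalType) (f : T -> T) n :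
  continuous f -> continuous (iter n f).
Proof.
move=> cf; elim: n => [|n ih] x; first exact: cvg_id.
by apply: (@continuous_comp _ _ _ (iter n f) f); [exact: ih|exact: cf].
Qed.

Lemma H4_continuous (R : realType) : continuous (@H4 R).
Proof. exact/iter_continuous/Hmap_continuous. Qed.

Lemma HmapE (R : realType) (v : 'rV[R]_3) :
  Hmap v = vec3 [:: henon_step (crd v 1) (crd v 2); crd v 0; crd v 1].
Proof. by []. Qed.

Lemma H4E (R : realType) (v : 'rV[R]_3) :
  let x1 := henon_step (crd v 1) (crd v 2) in
  let x2 := henon_step (crd v 0) (crd v 1) in
  H4 v = vec3 [:: henon_step x2 x1; henon_step x1 (crd v 0); x2].
Proof. by rewrite /H4 /= !HmapE !crdE. Qed.

Lemma HmapK (R : realType) : cancel (@Hmap R) Hinv.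
Proof.
by move=> v; apply: rV3P; rewrite /Hinv !crdE //= /dec; field.
Qed.

Lemma HinvK (R : realType) : cancel (@Hinv R) Hmap.
Proof.
by move=> v; apply: rV3P; rewrite /Hmap !crdE //= /dec; field.
Qed.

Section HSets.
Variable R : realType.

Lemma affinv_continuous (cy w : R) : continuous (affinv (center R cy) (frame R w)).
Proof.
rewrite (funext (affinvE R cy w)).
have cp : continuous (@ucoord1 R).
  by apply/entry_continuous => x; exact: cvg_fst.
have cq : continuous (@ucoord2 R).
  by apply/entry_continuous => x; exact: cvg_fst.
have cr : continuous (@scoord R).
  by apply/entry_continuous => x; exact: cvg_snd.
have cZ (k : R) (f : 'rV[R]_2 * 'rV[R]_1 -> R) :
    continuous f -> continuous (fun p => k * f p).
  by move=> cf; apply: mul_fun_continuous => //; exact: cst_fun_continuous.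
apply: vec3_continuous.
- apply: sub_fun_continuous; last exact: cZ.
  by apply: add_fun_continuous; [exact: cst_fun_continuous|exact: cZ].
- by apply: add_fun_continuous; [exact: cst_fun_continuous|exact: cZ].
- apply: sub_fun_continuous; last exact: cZ.
  by apply: sub_fun_continuous; [exact: cst_fun_continuous|exact: cZ].
Qed.

Lemma norm1_cases (x : R) : `|x| = 1 -> x = 1 \/ x = -1.
Proof. by case: (ger0P x) => _ <-; [left|right]; rewrite ?opprK. Qed.

Lemma aff_continuous (cy w : R) : w != 0 -> continuous (aff (center R cy) (frame R w)).
Proof.
move=> w0.
have cc k (a b : R) : continuous (fun v : 'rV[R]_3 => a * (crd v k - b)).
  apply: mul_fun_continuous; first exact: cst_fun_continuous.
  by apply: sub_fun_continuous; [exact: crd_continuous|exact: cst_fun_continuous].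
have cD (a : R) (f : 'rV[R]_3 -> R) : continuous f -> continuous (fun v : 'rV[R]_3 => f v / a).
  by move=> cf; apply: mul_fun_continuous => //; exact: cst_fun_continuous.
have -> : aff (center R cy) (frame R w) = fun v =>
   ((aff (center R cy) (frame R w) v).1, (aff (center R cy) (frame R w) v).2).
  by apply: funext => v; rewrite -surjective_pairing.
apply: pair_continuous; apply: rV_continuous => -[[|[|//]] hi] //.
- rewrite (_ : Ordinal hi = ord0); last exact/val_inj.
  rewrite (_ : (fun v => _) = fun v => w^-1 * (crd v 1 - cy)); first exact: cc.
  by apply: funext => v; have [h _ _] := affE _ cy w v w0; rewrite mulrC.
- rewrite (_ : Ordinal hi = ord_max); last exact/val_inj.
  rewrite (_ : (fun v => _) = fun v =>
    (6 / 100 * (crd v 0 - 81 / 100) - 3 / 100 * (crd v 2 - 39 / 40)) / (57 / 4000)).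
    by apply/cD/sub_fun_continuous; exact: cc.
  by apply: funext => v; have [_ h _] := affE _ cy w v w0.
- rewrite (_ : Ordinal hi = ord0); last exact/val_inj.
  rewrite (_ : (fun v => _) = fun v => (0 - (19 / 100 * (crd v 2 - 39 / 40)
    + 19 / 200 * (crd v 0 - 81 / 100))) / (57 / 4000)).
    apply/cD/sub_fun_continuous; first exact: cst_fun_continuous.
    by apply: add_fun_continuous; exact: cc.
  by apply: funext => v; have [_ _ h] := affE _ cy w v w0; rewrite sub0r.
Qed.

Lemma cube_compact u s : compact (@cube R u s).
Proof.
have norm_le1 n : [set v : 'rV[R]_n | `|v| <= 1] =
    [set v | forall i, `[-1, 1]%classic (v ord0 i)].
  apply/seteqP; split=> v /=.
    by move=> /(rV_norm_leP _ _ _ 1 ler01) h i; rewrite in_itv /= -ler_norml.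
  by move=> h; apply/(rV_norm_leP _ _ _ 1 ler01) => i; have := h i; rewrite in_itv /= -ler_norml.
have -> : cube u s = [set v : 'rV[R]_u | `|v| <= 1] `*` [set v : 'rV[R]_s | `|v| <= 1].
  by [].
by rewrite !norm_le1; apply: compact_setX;
  apply: (@rV_compact R _ (fun=> `[-1, 1]%classic)) => _; exact: segment_compact.
Qed.

Lemma affine_is_hset (cy w : R) : w != 0 ->
  is_hset 3 2 1 (affinv (center R cy) (frame R w) @` cube 2 1)
    (aff (center R cy) (frame R w)) (affinv (center R cy) (frame R w)).
Proof.
move=> w0; split; [|split; [|split; [|split; [|split; [|split]]]]] => //.
- apply: continuous_compact; last exact: cube_compact.
  exact/continuous_subspaceT/affinv_continuous.
- exact: aff_continuous.
- exact: affinv_continuous.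
- exact: affK.
- exact: affinvK.
- rewrite image_comp /comp; under eq_imagel do rewrite affinvK //.
  exact: image_id.
Qed.

(* [s] tells whether [H4] preserves or reverses the first unstable coordinate. *)
Lemma henon_covers (s cy w cy' w' : R) :
  0 < w -> 0 < w' -> s = 1 \/ s = -1 ->
  84 / 100 <= cy - w -> cy + w <= 161 / 100 ->
  84 / 100 <= cy' - w' -> cy' + w' <= 161 / 100 ->
  (forall q r x z : R, -1 <= q <= 1 -> -1 <= r <= 1 ->
    x = 81 / 100 + 19 / 100 * q - 3 / 100 * r ->
    z = 39 / 40 - 19 / 200 * q - 6 / 100 * r ->
    henon_step (henon_step (cy - s * w) z) x < 84 / 100 /\
    161 / 100 < henon_step (henon_step (cy + s * w) z) x) ->
  covers 3 2 1 (affinv (center R cy) (frame R w)) (aff (center R cy') (frame R w')) H4.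
Proof.
move=> w0 w'0 s1 h1 h2 h1' h2' hp.
have w'n : w' != 0 by rewrite gt_eqF.
have ss : s * s = 1 by case: s1 => ->; rewrite ?mulrNN mulr1.
have sn : `|s| = 1 by case: s1 => ->; rewrite ?normrN normr1.
have y_bounds (e : R) : -1 <= e <= 1 -> 84 / 100 <= cy + w * e <= 161 / 100.
  move=> e1; have u1 : 0 <= w * (1 - e) by apply: mulr_ge0; lra.
  have u2 : 0 <= w * (1 + e) by apply: mulr_ge0; lra.
  by apply/andP; split; lra.
(* The target's [y]-range lies in [0.84, 1.61], so leaving this interval means leaving the
   target. *)
have p_exit (e X : R) : s * e = 1 /\ 161 / 100 < X \/ s * e = -1 /\ X < 84 / 100 ->
    1 < s * e * ((X - cy') / w').
  by move=> h; rewrite mulrA ltr_pdivlMr // mul1r; case: h => -[-> h]; lra.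
have q_exit (e X : R) : e = 1 /\ 57 / 4000 < X \/ e = -1 /\ X < - (57 / 4000) ->
    1 < e * (X / (57 / 4000)).
  by clear; move=> h; rewrite mulrA ltr_pdivlMr ?mul1r; [case: h => -[-> h]|]; lra.
have entry_scale (X Y : R) : (-(57 / 4000) <= X <= 57 / 4000 -> - (57 / 4000) < Y < 57 / 4000) ->
    `|X / (57 / 4000)| <= 1 -> `|- Y / (57 / 4000)| < 1.
  have k0 : 0 < 57 / 4000 :> R by clear; lra.
  clear - k0 => h; rewrite ler_norml ler_pdivlMr // ler_pdivrMr // mulN1r mul1r => /h {}h.
  by rewrite ltr_norml ltr_pdivlMr // ltr_pdivrMr // mulN1r mul1r ltrN2 andbC ltrNl.
(* Only the first unstable coordinate may be reversed; the second keeps its orientation. *)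
pose d : 'rV[R]_2 := \row_j (if j == ord0 then s else 1).
have gE p : let g := aff (center R cy') (frame R w') (H4 (affinv (center R cy) (frame R w) p)) in
  let x := 81 / 100 + 19 / 100 * ucoord2 R p - 3 / 100 * scoord R p in
  let y := cy + w * ucoord1 R p in
  let z := 39 / 40 - 19 / 200 * ucoord2 R p - 6 / 100 * scoord R p in
  let x1 := henon_step y z in
  let x2 := henon_step x y in
  [/\ ucoord1 R g = (henon_step x1 x - cy') / w',
    ucoord2 R g = (6 / 100 * (henon_step x2 x1 - 81 / 100)
      - 3 / 100 * (x2 - 39 / 40)) / (57 / 4000) &
    scoord R g = - (19 / 100 * (x2 - 39 / 40)
      + 19 / 200 * (henon_step x2 x1 - 81 / 100)) / (57 / 4000)].
  move=> g x y z x1 x2.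
  have [e1 e2 e3] := affE R cy' w' (H4 (affinv (center R cy) (frame R w) p)) w'n.
  by rewrite /g e1 e2 e3 affinvE H4E !crdE.
apply: (@covers_diag R 3 2 1 _ _ _ d) => [p|j|p j hp1 pj|p hp1 hg].
- apply: (@continuous_comp _ _ _ (H4 \o affinv (center R cy) (frame R w)));
    last exact: aff_continuous.
  apply: (@continuous_comp _ _ _ (affinv (center R cy) (frame R w)) H4).
    exact: affinv_continuous.
  exact: H4_continuous.
- by rewrite mxE; case: ifP => // _; rewrite normr1.
- have [bp bq br] := (cube_coordP R p).1 hp1.
  have := gE p; cbv zeta; set g := aff _ _ _; set x := 81 / 100 + _ - _.
  set y := cy + _; set z := 39 / 40 - _ - _ => -[gp gq _].
  have hy : 84 / 100 <= y <= 161 / 100 by exact: y_bounds.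
  have hx1 : - (95 / 100) <= henon_step y z <= 98 / 100.
    exact: (henon_step_bounds _ (ucoord2 R p) (scoord R p)).
  case: j pj => -[|[|//]] hj.
    rewrite (_ : Ordinal hj = ord0); last exact/val_inj.
    rewrite mxE eqxx -/(ucoord1 R p) -/g -/(ucoord1 R g) gp => pj; apply: p_exit.
    have [lo hi] := hp (ucoord2 R p) (scoord R p) x z bq br erefl erefl.
    have /norm1_cases[e|e] : `|s * ucoord1 R p| = 1 by rewrite normrM sn pj mulr1.
      left; split=> //; suff -> : y = cy + s * w by [].
      have pe : ucoord1 R p = s by rewrite -[LHS]mul1r -ss -mulrA e mulr1.
      by rewrite /y pe mulrC.
    right; split=> //; suff -> : y = cy - s * w by [].
    have pe : ucoord1 R p = - s by rewrite -[LHS]mul1r -ss -mulrA e mulrN1.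
    by rewrite /y pe mulrN mulrC.
  rewrite (_ : Ordinal hj = ord_max); last exact/val_inj.
  rewrite mxE /= mul1r -/(ucoord2 R p) -/g -/(ucoord2 R g) gq => /norm1_cases qe.
  apply: q_exit; case: qe => e; [left|right]; split=> //.
    have xe : x = 1 - 3 / 100 * scoord R p by rewrite /x e; clear; lra.
    by apply: exit_ucoord2_right br hx1 hy _; rewrite xe.
  have xe : x = 62 / 100 - 3 / 100 * scoord R p by rewrite /x e; clear; lra.
  by apply: exit_ucoord2_left br hx1 hy _; rewrite xe.
- have [bp bq br] := (cube_coordP R p).1 hp1.
  have := gE p; cbv zeta; move: hg; set g := aff _ _ _; set x := 81 / 100 + _ - _.
  set y := cy + _; set z := 39 / 40 - _ - _ => hg [_ gq gr].
  have hy : 84 / 100 <= y <= 161 / 100 by exact: y_bounds.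
  have hx : 59 / 100 <= x <= 103 / 100.
    by rewrite /x; clear - bq br; apply/andP; split; lra.
  have hx1 : - (95 / 100) <= henon_step y z <= 98 / 100.
    exact: (henon_step_bounds _ (ucoord2 R p) (scoord R p)).
  have [->|/rV_norm_attained[j ->]] := eqVneq `|g.2| 0; first exact: ltr01.
  rewrite (ord1 j) -/(scoord R g) gr; apply: entry_scale.
    exact: scoord_bound hx hx1 hy erefl.
  by rewrite -gq; exact: (rV_norm_leP _ _ _ 1 ler01).1 hg ord_max.
Qed.

End HSets.

Lemma a_hsetE (R : realType) : (@Cainv R = affinv (center R (dec 409 400)) (frame R (dec 73 400))) *
  (@Ca R = aff (center R (dec 409 400)) (frame R (dec 73 400))).
Proof. by []. Qed.

Lemma b_hsetE (R : realType) : (@Cbinv R = affinv (center R (dec 119 80)) (frame R (dec 49 400))) *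
  (@Cb R = aff (center R (dec 119 80)) (frame R (dec 49 400))).
Proof. by []. Qed.

(** The image stretches across [0.84, 1.61], which contains both [y]-ranges, so a free target frame
    serves [a] and [b] at once. Over [a] the value x1 is positive and decreases in [y], so x3
    increases. *)
Lemma a_covers (R : realType) (cy w : R) : 0 < w ->
  84 / 100 <= cy - w -> cy + w <= 161 / 100 ->
  covers 3 2 1 Cainv (aff (center R cy) (frame R w)) H4.
Proof.
move=> w0 h1 h2; rewrite a_hsetE; apply: (henon_covers _ 1) => //; rewrite ?/dec; try lra.
move=> q r x z hq hr hx hz; split.
  rewrite (_ : _ - _ = 84 / 100); first exact: henon_step2_left_a hz.
  lra.
rewrite (_ : _ + _ = 1205 / 1000); first exact: henon_step2_right_a hz.
lra.
Qed.

(** Over [b] the value x1 is negative and decreases in [y], so its square grows and x3 decreases: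
    the orientation is reversed. *)
Lemma b_covers (R : realType) (cy w : R) : 0 < w ->
  84 / 100 <= cy - w -> cy + w <= 161 / 100 ->
  covers 3 2 1 Cbinv (aff (center R cy) (frame R w)) H4.
Proof.
move=> w0 h1 h2; rewrite b_hsetE; apply: (henon_covers _ (-1)) => //; rewrite ?/dec; try lra.
move=> q r x z hq hr hx hz; split.
  rewrite (_ : _ - _ = 161 / 100); first exact: henon_step2_right_b hz.
  lra.
rewrite (_ : _ + _ = 1365 / 1000); first exact: henon_step2_left_b hz.
lra.
Qed.

(** * Inverse branches *)

(* Intervals that the inverse branches [u |-> +- sqrt (1.76 - v - 0.1 t)] of the
   recursion map into each other. *)
Definition in_xbox {R : realFieldType} (x : R) := 735 / 1000 <= x <= 890 / 1000.
Definition in_ybox {R : realFieldType} (y : R) := 863 / 1000 <= y <= 1607 / 1000.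
Definition in_zbox {R : realFieldType} (z : R) := 882 / 1000 <= z <= 1057 / 1000.
Definition in_wbox {R : realFieldType} (w : R) := 252 / 1000 <= w <= 908 / 1000.

Lemma le_of_sqr_le (R : realDomainType) (a b : R) : 0 <= b -> a ^+ 2 <= b ^+ 2 -> a <= b.
Proof.
move=> b0 h; have [a0|a0] := lerP 0 a; last exact: le_trans (ltW a0) b0.
by rewrite -(ler_pXn2r (n := 2)).
Qed.

Lemma sqrt_between (R : rcfType) (a b t : R) : 0 <= a -> 0 <= b ->
  a ^+ 2 <= t <= b ^+ 2 -> a <= Num.sqrt t <= b.
Proof.
move=> a0 b0 /andP[h1 h2].
have t0 : 0 <= t by apply: le_trans h1; exact: sqr_ge0.
by apply/andP; split; apply: le_of_sqr_le => //; rewrite ?sqrtr_ge0 ?sqr_sqrtr.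
Qed.

Section Branches.
Variables (R : rcfType).
Implicit Types x y z w s : R.

(** In this part (x, y, z) is a point of an orbit of [H4] and [w] is its value x1, the only variable
    whose sign depends on the itinerary. Here [y] belongs to the next point, whose second coordinate
    is x3. *)
Lemma w_branch_box x y : in_xbox x -> in_ybox y ->
  in_wbox (Num.sqrt (176 / 100 - y - 1 / 10 * x)).
Proof.
rewrite /in_xbox /in_ybox => hx hy.
by apply: sqrt_between; [lra|lra|apply/andP; split; lra].
Qed.

Lemma y_branch_box s w z : s = 1 \/ s = -1 -> in_wbox (s * w) -> in_zbox z ->
  in_ybox (Num.sqrt (176 / 100 - w - 1 / 10 * z)).
Proof.
rewrite /in_wbox /in_zbox => hs hw hz.
have {hs}hw : - (908 / 1000) <= w <= 908 / 1000.
  by case: hs hw => ->; rewrite ?mulN1r ?mul1r => hw; lra.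
by apply: sqrt_between; [lra|lra|apply/andP; split; lra].
Qed.

Lemma x_branch_box y z : in_ybox y -> in_zbox z ->
  in_xbox (Num.sqrt (176 / 100 - z - 1 / 10 * y)).
Proof.
rewrite /in_ybox /in_zbox => hy hz.
by apply: sqrt_between; [lra|lra|apply/andP; split; lra].
Qed.

Lemma z_branch_box s w x : s = 1 \/ s = -1 -> in_wbox (s * w) -> in_xbox x ->
  in_zbox (Num.sqrt (176 / 100 - x - 1 / 10 * w)).
Proof.
rewrite /in_wbox /in_xbox => hs hw hx.
have {hs}hw : - (908 / 1000) <= w <= 908 / 1000.
  by case: hs hw => ->; rewrite ?mulN1r ?mul1r => hw; lra.
by apply: sqrt_between; [lra|lra|apply/andP; split; lra].
Qed.

End Branches.

(** * Contraction estimates for the inverse branches *)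

Section Contraction.
Variable (R : realFieldType).
Implicit Types x y z w s D S e : R.

(* Division-free form of [|a - b| = |a^2 - b^2| / (a + b)]. *)
Lemma sqr_dist_le (a b c e S : R) : 0 < S -> S <= a + b ->
  `|a ^+ 2 - b ^+ 2| <= c -> c <= e * S -> `|a - b| <= e.
Proof.
move=> S0 Sab h1 h2; rewrite -(ler_pM2r S0); apply: le_trans h2; apply: le_trans h1.
rewrite subr_sqr normrM ler_wpM2l ?normr_ge0 //.
by apply: le_trans Sab _; exact: ler_norm.
Qed.

(** Both values have the sign [s], so the absolute value of their sum is [s * w1 + s * w2]. The
    bound stays undivided because [y_branch_contr] plays this sum off against [y1 + y2]. *)
Lemma w_branch_dist s (w1 w2 x1 x2 y1 y2 D : R) : s = 1 \/ s = -1 ->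
  in_wbox (s * w1) -> in_wbox (s * w2) ->
  w1 ^+ 2 = 176 / 100 - y1 - 1 / 10 * x1 -> w2 ^+ 2 = 176 / 100 - y2 - 1 / 10 * x2 ->
  `|y1 - y2| <= D -> `|x1 - x2| <= D ->
  `|w1 - w2| * (s * w1 + s * w2) <= 11 / 10 * D.
Proof.
move=> hs h1 h2 e1 e2; rewrite !ler_norml => hy hx.
have -> : `|w1 - w2| * (s * w1 + s * w2) = `|w1 ^+ 2 - w2 ^+ 2|.
  rewrite subr_sqr normrM; congr (_ * _).
  rewrite -mulrDr -[LHS]ger0_norm; last by move: h1 h2; rewrite /in_wbox; lra.
  by rewrite normrM; case: hs => ->; rewrite ?normrN normr1 mul1r.
by rewrite e1 e2 ler_norml; apply/andP; split; lra.
Qed.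

Lemma x_branch_contr (x1 x2 y1 y2 z1 z2 D : R) : in_xbox x1 -> in_xbox x2 ->
  x1 ^+ 2 = 176 / 100 - z1 - 1 / 10 * y1 -> x2 ^+ 2 = 176 / 100 - z2 - 1 / 10 * y2 ->
  `|y1 - y2| <= D -> `|z1 - z2| <= D -> `|x1 - x2| <= 97 / 100 * D.
Proof.
rewrite /in_xbox => h1 h2 e1 e2 hy hz.
have D0 : 0 <= D by apply: le_trans hy; exact: normr_ge0.
(* Here 147/100 is twice the lower end of [in_xbox], and 11/10 adds the coefficients 1 and 1/10. *)
apply: (@sqr_dist_le _ _ (11 / 10 * D) _ (147 / 100)).
- by clear; lra.
- by clear - h1 h2; lra.
- move: hy hz; rewrite e1 e2 !ler_norml; clear => hy hz.
  by apply/andP; split; lra.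
- by clear - D0; lra.
Qed.

Lemma z_branch_contr s (w1 w2 x1 x2 x1' x2' y1 y2 z1 z2 D : R) : s = 1 \/ s = -1 ->
  in_wbox (s * w1) -> in_wbox (s * w2) -> in_zbox z1 -> in_zbox z2 ->
  w1 ^+ 2 = 176 / 100 - y1 - 1 / 10 * x1 -> w2 ^+ 2 = 176 / 100 - y2 - 1 / 10 * x2 ->
  z1 ^+ 2 = 176 / 100 - x1' - 1 / 10 * w1 -> z2 ^+ 2 = 176 / 100 - x2' - 1 / 10 * w2 ->
  `|y1 - y2| <= D -> `|x1 - x2| <= D -> `|x1' - x2'| <= D ->
  `|z1 - z2| <= 97 / 100 * D.
Proof.
move=> hs h1 h2; rewrite /in_zbox => hz1 hz2 e1 e2 e1' e2' hy hx hx'.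
have D0 : 0 <= D by apply: le_trans hy; exact: normr_ge0.
have hw := w_branch_dist s w1 w2 x1 x2 y1 y2 D hs h1 h2 e1 e2 hy hx.
have {}hw : `|w1 - w2| <= 22 / 10 * D.
  have h : `|w1 - w2| * (1 / 2) <= `|w1 - w2| * (s * w1 + s * w2).
    rewrite ler_wpM2l ?normr_ge0 //; move: h1 h2; rewrite /in_wbox.
    by move: (s * w1) (s * w2); clear => a b; lra.
  by move: (le_trans h hw); move: `|_|; clear - D0 => t; lra.
(* The squares differ by at most (1 + 0.1 * 2.2) D = 1.22 D, and 176/100 is just below twice the
   lower end of [in_zbox]. *)
apply: (@sqr_dist_le _ _ (132 / 100 * D) _ (176 / 100)).
- by clear; lra.
- by clear - hz1 hz2; lra.
- move: hw hx'; rewrite e1' e2' !ler_norml; clear => hw hx'.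
  by apply/andP; split; lra.
- by clear - D0; lra.
Qed.

(* The left-hand side is a chord of [v |-> sqrt (1.6543 - v)] over [0.252, 0.908]. *)
Lemma y_branch_chord s (w z y : R) : s = 1 \/ s = -1 ->
  in_wbox (s * w) -> in_zbox z -> 0 <= y -> y ^+ 2 = 176 / 100 - w - 1 / 10 * z ->
  1307 / 1000 - 489 / 1000 * (s * w) <= y.
Proof.
rewrite /in_wbox /in_zbox => hs bw bz y0 ey; apply: le_of_sqr_le => //; rewrite ey.
have wv : w <= s * w.
  by case: hs bw => ->; rewrite ?mulN1r ?mul1r; clear; lra.
move: (s * w) bw wv => v bw wv.
(* The squared claim is a convex quadratic inequality in [v], so it suffices that it holds at both
   ends of the interval. *)
have : (v - 252 / 1000) * (908 / 1000 - v) >= 0.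
  by clear - bw; apply: mulr_ge0; lra.
by clear - wv bz bw => hv; lra.
Qed.

(* The crude bounds on [w] and [y] taken separately do not give a contraction; the
   chord bound exploits that [y] is large when [|w|] is small. *)
Lemma y_branch_contr s (w1 w2 x1 x2 y1' y2' y1 y2 z1 z2 D : R) : s = 1 \/ s = -1 ->
  in_wbox (s * w1) -> in_wbox (s * w2) -> in_zbox z1 -> in_zbox z2 ->
  0 <= y1 -> 0 <= y2 ->
  w1 ^+ 2 = 176 / 100 - y1' - 1 / 10 * x1 -> w2 ^+ 2 = 176 / 100 - y2' - 1 / 10 * x2 ->
  y1 ^+ 2 = 176 / 100 - w1 - 1 / 10 * z1 -> y2 ^+ 2 = 176 / 100 - w2 - 1 / 10 * z2 ->
  `|y1' - y2'| <= D -> `|x1 - x2| <= D -> `|z1 - z2| <= D ->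
  `|y1 - y2| <= 97 / 100 * D.
Proof.
move=> hs h1 h2 hz1 hz2 y10 y20 e1 e2 e1' e2' hy hx hz.
have D0 : 0 <= D by apply: le_trans hy; exact: normr_ge0.
have hw := w_branch_dist s w1 w2 x1 x2 y1' y2' D hs h1 h2 e1 e2 hy hx.
have k1 := y_branch_chord s w1 z1 y1 hs h1 hz1 y10 e1'.
have k2 := y_branch_chord s w2 z2 y2 hs h2 hz2 y20 e2'.
have Sb : 504 / 1000 <= s * w1 + s * w2 <= 1816 / 1000.
  move: h1 h2; rewrite /in_wbox; move: (s * w1) (s * w2); clear => a b ha hb.
  by apply/andP; split; lra.
have Yb : 2614 / 1000 - 489 / 1000 * (s * w1 + s * w2) <= y1 + y2.
  by move: k1 k2; move: (s * w1) (s * w2); clear => a b; lra.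
move: (s * w1 + s * w2) hw Sb Yb => S hw Sb Yb.
have S0 : 0 < S by clear - Sb; lra.
have Y0 : 0 < y1 + y2 by clear - Sb Yb; lra.
move: (y1 + y2) Y0 Yb (subr_sqr y1 y2) => Y Y0 Yb sqY.
(* This is what the rate 97/100 requires. The lower bound for [Y * S] is concave in [S], so the ends
   of [Sb] decide; the tight one is S = 0.504, where 1.1504 faces about 1.157. *)
have SY : 11 / 10 + 1 / 10 * S <= 97 / 100 * (Y * S).
  have : (2614 / 1000 - 489 / 1000 * S) * S <= Y * S by rewrite ler_wpM2r // ltW.
  have : (S - 504 / 1000) * (1816 / 1000 - S) >= 0.
    by clear - Sb; apply: mulr_ge0; lra.
  by move: (Y * S) => YS; clear - Sb; lra.
have : `|y1 - y2| * (Y * S) <= 97 / 100 * D * (Y * S).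
  have -> : `|y1 - y2| * (Y * S) = `|(w1 - w2) + 1 / 10 * (z1 - z2)| * S.
    rewrite mulrA -[Y]gtr0_norm // -normrM -sqY e1' e2' -normrN.
    by congr (`|_| * _); ring.
  apply: (@le_trans _ _ ((`|w1 - w2| + 1 / 10 * D) * S)).
    rewrite ler_wpM2r ?(ltW S0) //; apply: le_trans (ler_normD _ _) _.
    by rewrite lerD2l normrM ger0_norm ?ler_wpM2l // divr_ge0.
  apply: (@le_trans _ _ (D * (11 / 10 + 1 / 10 * S))).
    by rewrite [leLHS]mulrDl; move: (`|w1 - w2| * S) hw; clear => t; lra.
  have -> : 97 / 100 * D * (Y * S) = D * (97 / 100 * (Y * S)) by ring.
  by rewrite ler_wpM2l.
by rewrite ler_pM2r // mulr_gt0.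
Qed.

End Contraction.

(** * Orbits with prescribed itinerary *)

(** The telescoping series is dominated by a geometric one. Applied to each coordinate of the
    sweeps, this provides the fixed point of the contraction. *)
Lemma cvgn_of_geometric_increments (R : realType) (a : R^nat) (k : R) :
  0 <= k < 1 -> (forall n, `|a n.+1 - a n| <= k ^+ n) -> cvgn a.
Proof.
move=> /andP[k0 k1] h.
have ks : cvgn (series (geometric 1 k)).
  by apply: is_cvg_geometric_series; rewrite ger0_norm.
have cs : cvgn (series (telescope a)).
  apply: normed_cvg; apply: (series_le_cvg _ _ _ ks) => n /=; rewrite ?mul1r.
  - exact: normr_ge0.
  - exact: exprn_ge0.
  - exact: h.
have -> : a = (fun n => a 0%N + series (telescope a) n).
  by apply: funext => n; exact: eq_sum_telescope.
by apply: is_cvgD => //; exact: is_cvg_cst.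
Qed.

Section Orbits.
Variables (R : realType) (l : int -> bool).

(** The symbol [true] stands for [b], over which x1 is negative. *)
Let sg k : R := if l k then -1 else 1.

Definition w_of (u : int -> R * R * R) k : R :=
  sg k * Num.sqrt (176 / 100 - (u (k + 1)).1.2 - 1 / 10 * (u k).1.1).

(* One sweep of the inverse branches prescribed by [l]; its fixed points are the
   orbits [u k = (x, y, z)] of [H4] with itinerary [l]. *)
Definition branch_sweep (u : int -> R * R * R) (k : int) : R * R * R :=
  (Num.sqrt (176 / 100 - (u (k + 1)).2 - 1 / 10 * (u k).1.2),
   Num.sqrt (176 / 100 - w_of u k - 1 / 10 * (u k).2),
   Num.sqrt (176 / 100 - (u k).1.1 - 1 / 10 * w_of u (k - 1))).

Definition in_box (p : R * R * R) := [/\ in_xbox p.1.1, in_ybox p.1.2 & in_zbox p.2].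

Definition box_dist_le D (p q : R * R * R) :=
  [/\ `|p.1.1 - q.1.1| <= D, `|p.1.2 - q.1.2| <= D & `|p.2 - q.2| <= D].

Lemma sgP k : sg k = 1 \/ sg k = -1.
Proof. by rewrite /sg; case: (l k); [right|left]. Qed.

Lemma sg_w_of u k : (forall j, in_box (u j)) -> in_wbox (sg k * w_of u k).
Proof.
move=> hu; rewrite /w_of mulrA; have -> : sg k * sg k = 1.
  by case: (sgP k) => ->; rewrite ?mulrNN mulr1.
by rewrite mul1r; have [] := hu k; have [] := hu (k + 1) => *; exact: w_branch_box.
Qed.

Lemma w_of_sqr u k : (forall j, in_box (u j)) ->
  w_of u k ^+ 2 = 176 / 100 - (u (k + 1)).1.2 - 1 / 10 * (u k).1.1.
Proof.
move=> hu; rewrite /w_of exprMn sqr_sqrtr.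
  by case: (sgP k) => ->; ring.
by have [] := hu k; have [] := hu (k + 1); rewrite /in_xbox /in_ybox; lra.
Qed.

Lemma branch_sweep_box u : (forall j, in_box (u j)) -> forall k, in_box (branch_sweep u k).
Proof.
move=> hu k; have [hx hy hz] := hu k; have [_ _ hz'] := hu (k + 1).
split; first exact: x_branch_box.
  exact: (y_branch_box _ _ _ _ (sgP k) (sg_w_of _ _ hu)).
exact: (z_branch_box _ _ _ _ (sgP (k - 1)) (sg_w_of _ _ hu)).
Qed.

(** Since [Num.sqrt] is 0 on negative arguments, a positive lower bound on the root already makes
    [t] positive. *)
Lemma sqrtr_box (a b t : R) : 0 < a -> a <= Num.sqrt t <= b -> Num.sqrt t ^+ 2 = t.
Proof.
move=> a0 /andP[h _]; apply: sqr_sqrtr; apply: ltW; rewrite -sqrtr_gt0.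
exact: lt_le_trans h.
Qed.

Lemma branch_sweep_eq u : (forall j, in_box (u j)) -> forall k,
  [/\ (branch_sweep u k).1.1 ^+ 2 = 176 / 100 - (u (k + 1)).2 - 1 / 10 * (u k).1.2,
   (branch_sweep u k).1.2 ^+ 2 = 176 / 100 - w_of u k - 1 / 10 * (u k).2 &
   (branch_sweep u k).2 ^+ 2 = 176 / 100 - (u k).1.1 - 1 / 10 * w_of u (k - 1)].
Proof.
move=> hu k; have [hx hy hz] := branch_sweep_box _ hu k.
by split; [apply: sqrtr_box hx|apply: sqrtr_box hy|apply: sqrtr_box hz];
  apply: divr_gt0; rewrite ltr0n.
Qed.

Lemma branch_sweep_contr u v D : (forall j, in_box (u j)) -> (forall j, in_box (v j)) ->
  (forall j, box_dist_le D (u j) (v j)) ->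
  forall k, box_dist_le (97 / 100 * D) (branch_sweep u k) (branch_sweep v k).
Proof.
move=> hu hv huv k.
have [ux uy uz] := branch_sweep_box _ hu k; have [vx vy vz] := branch_sweep_box _ hv k.
have [eux euy euz] := branch_sweep_eq _ hu k; have [evx evy evz] := branch_sweep_eq _ hv k.
have [dx dy dz] := huv k; have [dx1 dy1 dz1] := huv (k + 1); have [dx0 dy0 dz0] := huv (k - 1).
have [_ _ hzu] := hu k; have [_ _ hzv] := hv k.
split.
- exact: (x_branch_contr _ _ _ _ _ _ _ _ ux vx eux evx).
- apply: (y_branch_contr _ _ _ _ _ _ _ _ _ _ _ _ D (sgP k) (sg_w_of _ _ hu) (sg_w_of _ _ hv)
    hzu hzv _ _ (w_of_sqr _ _ hu) (w_of_sqr _ _ hv) euy evy) => //; exact: sqrtr_ge0.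
- apply: (z_branch_contr _ _ _ _ _ _ _ _ _ _ _ _ D (sgP (k - 1)) (sg_w_of _ _ hu) (sg_w_of _ _ hv)
    uz vz (w_of_sqr _ _ hu) (w_of_sqr _ _ hv) euz evz) => //.
  (* The value [w_of] at [k - 1] refers to the [y] at [k - 1 + 1], that is, at [k]. *)
  by rewrite subrK.
Qed.

Definition sweeps n := iter n branch_sweep (fun=> (8 / 10, 1, 9 / 10)).

Lemma sweeps_box n k : in_box (sweeps n k).
Proof.
elim: n k => [|n ih] k /=; last exact: branch_sweep_box.
by split; rewrite /in_xbox /in_ybox /in_zbox /=; apply/andP; split; lra.
Qed.

Lemma sweeps_dist n k : box_dist_le ((97 / 100) ^+ n) (sweeps n.+1 k) (sweeps n k).
Proof.
elim: n k => [|n ih] k; last first.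
  rewrite exprS; exact: (branch_sweep_contr _ _ _ (sweeps_box n.+1) (sweeps_box n) ih).
(* All sides of the box are shorter than 1, the zeroth power of the rate. *)
have [] := sweeps_box 1 k; have [] := sweeps_box 0 k.
have interval_diam (lo hi a b : R) :
    hi <= lo + 1 -> lo <= a <= hi -> lo <= b <= hi -> `|a - b| <= 1.
  by move=> ? ? ?; rewrite ler_norml; apply/andP; split; lra.
by move=> *; rewrite expr0; split;
  [apply: (interval_diam (735 / 1000) (890 / 1000))
  |apply: (interval_diam (863 / 1000) (1607 / 1000))
  |apply: (interval_diam (882 / 1000) (1057 / 1000))] => //; lra.
Qed.

Lemma itinerary_orbit : exists u : int -> R * R * R, exists w : int -> R, forall k,
  [/\ in_box (u k), in_wbox (sg k * w k),
      w k = henon_step (u k).1.2 (u k).2,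
      (u (k + 1)).1.2 = henon_step (w k) (u k).1.1 &
      (u (k + 1)).2 = henon_step (u k).1.1 (u k).1.2 /\
      (u k).1.1 = henon_step (u k).2 (w (k - 1))].
Proof.
have k01 : 0 <= (97 / 100 : R) < 1 by apply/andP; split; lra.
have cx k : cvgn (fun n => (sweeps n k).1.1).
  by apply: (cvgn_of_geometric_increments _ _ _ k01) => n; have [] := sweeps_dist n k.
have cy k : cvgn (fun n => (sweeps n k).1.2).
  by apply: (cvgn_of_geometric_increments _ _ _ k01) => n; have [] := sweeps_dist n k.
have cz k : cvgn (fun n => (sweeps n k).2).
  by apply: (cvgn_of_geometric_increments _ _ _ k01) => n; have [] := sweeps_dist n k.
pose x k := limn (fun n => (sweeps n k).1.1).
pose y k := limn (fun n => (sweeps n k).1.2).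
pose z k := limn (fun n => (sweeps n k).2).
pose w k := henon_step (y k) (z k).
have cS (f : R^nat) (a : R) : f @ \oo --> a -> (fun n => f n.+1) @ \oo --> a.
  by move=> h; rewrite (_ : (fun n => f n.+1) = [sequence f n.+1]_n) // cvg_shiftS.
have chenon (f g : R^nat) (a b : R) : f @ \oo --> a -> g @ \oo --> b ->
    (fun n => henon_step (f n) (g n)) @ \oo --> henon_step a b.
  move=> cf cg; apply: cvgB; last by apply: cvgM => //; exact: cvg_cst.
  by apply: cvgB; [exact: cvg_cst|rewrite expr2; apply: cvgM].
(* Solving the [y]-equation of the sweep for [w_of] expresses it as [henon_step] of two convergent
   sequences. *)
have cw k : (fun n => w_of (sweeps n) k) @ \oo --> w k.
  have -> : (fun n => w_of (sweeps n) k) =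
      (fun n => henon_step (sweeps n.+1 k).1.2 (sweeps n k).2).
    apply: funext => n; rewrite /henon_step.
    by have [_ e _] := branch_sweep_eq _ (sweeps_box n) k; rewrite /= e; ring.
  exact: (chenon _ _ _ _ (cS _ _ (cy k)) (cz k)).
have lim_box (f : R^nat) (a lo hi : R) : f @ \oo --> a ->
    (forall n, lo <= f n <= hi) -> lo <= a <= hi.
  move=> cf h; apply/andP; split.
    by apply: (cvgr_to_ge cf); apply: nearW => n; have /andP[] := h n.
  by apply: (cvgr_to_le cf); apply: nearW => n; have /andP[] := h n.
have lim_eq (f g : R^nat) (a b : R) : f @ \oo --> a -> g @ \oo --> b -> f =1 g -> a = b.
  by move=> cf cg /funext e; move: cf; rewrite e => cf; exact: (cvg_unique _ cf cg).
exists (fun k => (x k, y k, z k)), w => k; split=> /=.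
- split=> /=.
  + by apply: (lim_box _ _ _ _ (cx k)) => n; have [] := sweeps_box n k.
  + by apply: (lim_box _ _ _ _ (cy k)) => n; have [] := sweeps_box n k.
  + by apply: (lim_box _ _ _ _ (cz k)) => n; have [] := sweeps_box n k.
- apply: (lim_box (fun n => sg k * w_of (sweeps n) k)).
    by apply: cvgM; [exact: cvg_cst|exact: cw].
  by move=> n; apply: sg_w_of; exact: sweeps_box.
- by [].
- apply: (lim_eq _ _ _ _ (cy (k + 1)) (chenon _ _ _ _ (cw k) (cx k))) => n.
  by rewrite /henon_step w_of_sqr; [ring|exact: sweeps_box].
- split.
    apply: (lim_eq _ _ _ _ (cz (k + 1)) (chenon _ _ _ _ (cS _ _ (cx k)) (cy k))) => n.
    by have [e _ _] := branch_sweep_eq _ (sweeps_box n) k; rewrite /henon_step /= e; ring.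
  apply: (lim_eq _ _ _ _ (cx k) (chenon _ _ _ _ (cS _ _ (cz k)) (cw (k - 1)))) => n.
  by have [_ _ e] := branch_sweep_eq _ (sweeps_box n) k; rewrite /henon_step /= e; ring.
Qed.

End Orbits.

(** * Symbolic dynamics *)

Lemma Negz_succ n : Negz n.+1 + 1 = Negz n.
Proof. by rewrite !NegzE intS opprD addrAC addNr add0r. Qed.

Section IntegerPowers.
Variables (T : Type) (F Fi : T -> T).

Lemma zpowS (FiK : cancel Fi F) k x : zpow F Fi (k + 1) x = F (zpow F Fi k x).
Proof.
case: k => [n|[|n]]; first by rewrite addrC -intS.
  by rewrite /= FiK.
by rewrite Negz_succ /= FiK.
Qed.

Lemma zpow_unique (FK : cancel F Fi) (g : int -> T) :
  (forall k, g (k + 1) = F (g k)) -> forall k, g k = zpow F Fi k (g 0).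
Proof.
move=> gS; have gP k : g k = Fi (g (k + 1)) by rewrite gS FK.
case=> n; first by elim: n => // n ih; rewrite [RHS]/= -[iter n F _]ih -gS addrC -intS.
by elim: n => [|n ih]; rewrite gP //= Negz_succ ih.
Qed.

Lemma zpow_continuous (U : topologicalType) (f fi : U -> U) k :
  continuous f -> continuous fi -> continuous (zpow f fi k).
Proof. by move=> cf cfi; case: k => n; exact: iter_continuous. Qed.

End IntegerPowers.

Section Itineraries.
Variable R : realType.
Implicit Types (v x : 'rV[R]_3) (k : int).

Lemma H4K : cancel (@H4 R) (iter 4 Hinv).
Proof. by move=> v; rewrite /H4 /= !HmapK. Qed.

Lemma H4powS k v : H4pow (k + 1) v = H4 (H4pow k v).
Proof.
rewrite /H4pow mulrDr mulr1 (_ : 4 * k + 4 = 4 * k + 1 + 1 + 1 + 1); last by ring.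
by rewrite !(zpowS _ _ _ (@HinvK R)).
Qed.

(** [H4pow] counts steps of [Hmap] and [Inv] counts steps of [H4]; both give the unique two-sided
    [H4]-orbit through [v]. *)
Lemma H4powE k v : H4pow k v = zpow H4 (iter 4 Hinv) k v.
Proof. exact: (zpow_unique _ _ _ H4K (H4pow^~ v) (fun j => H4powS j v)). Qed.

Lemma H4pow_H4 k v : H4pow k (H4 v) = H4pow (k + 1) v.
Proof.
rewrite H4powE.
rewrite (zpow_unique _ _ _ H4K (fun j => H4pow (j + 1) v) (fun j => H4powS (j + 1) v)).
by rewrite H4powS.
Qed.

Lemma aset_cube v : aset v <-> cube 2 1 (Ca v).
Proof.
have w0 : dec 73 400 != 0 :> R by rewrite /dec mulf_neq0 ?invr_neq0 ?pnatr_eq0.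
split=> [[p hp <-]|h]; first by rewrite /Ca /Cainv [aff _ _ _]affinvK.
by exists (Ca v) => //; exact: affK.
Qed.

Lemma bset_cube v : bset v <-> cube 2 1 (Cb v).
Proof.
have w0 : dec 49 400 != 0 :> R by rewrite /dec mulf_neq0 ?invr_neq0 ?pnatr_eq0.
split=> [[p hp <-]|h]; first by rewrite /Cb /Cbinv [aff _ _ _]affinvK.
by exists (Cb v) => //; exact: affK.
Qed.

Lemma aset_crd1 v : aset v -> crd v 1 <= 1205 / 1000.
Proof.
case=> p /(cube_coordP R p)[hp _ _] <-.
rewrite [Cainv _](affinvE R (dec 409 400) (dec 73 400)) crdE //= /dec; lra.
Qed.

Lemma bset_crd1 v : bset v -> 1365 / 1000 <= crd v 1.
Proof.
case=> p /(cube_coordP R p)[hp _ _] <-.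
rewrite [Cbinv _](affinvE R (dec 119 80) (dec 49 400)) crdE //= /dec; lra.
Qed.

Lemma bset_gmap v k : bset (H4pow k v) -> gmap v k = true.
Proof.
move=> /bset_crd1 h; rewrite /gmap; apply/asboolPn => /aset_crd1; lra.
Qed.

Lemma aset_gmap v k : aset (H4pow k v) -> gmap v k = false.
Proof. by move=> h; rewrite /gmap; apply/negbTE; rewrite negbK; exact/asboolP. Qed.

Lemma Iset_H4pow v : Iset v <-> forall k, (aset `|` bset) (H4pow k v).
Proof.
split=> [[_ h] k|h]; first by rewrite H4powE.
by split=> [|k]; [exact: (h 0)|rewrite -H4powE].
Qed.

(** The [y]-ranges of [a] and [b] are separated by the gap from 1.205 to 1.365, of length 0.16. *)
Lemma gmap_eq x v k : Iset x -> Iset v ->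
  `|crd (H4pow k x) 1 - crd (H4pow k v) 1| < 16 / 100 -> gmap x k = gmap v k.
Proof.
move=> /Iset_H4pow/(_ k) hx /Iset_H4pow/(_ k) hv; rewrite ltr_norml => d.
case: hx => hx; case: hv => hv.
- by rewrite !aset_gmap.
- by have := aset_crd1 _ hx; have := bset_crd1 _ hv; lra.
- by have := bset_crd1 _ hx; have := aset_crd1 _ hv; lra.
- by rewrite !bset_gmap.
Qed.

Lemma gmap_locally_eq x N : Iset x -> \forall v \near x, Iset v ->
  forall n : nat, (n < N)%N -> gmap x n = gmap v n /\ gmap x (Negz n) = gmap v (Negz n).
Proof.
move=> Ix.
have loc k : \forall v \near x, Iset v -> gmap x k = gmap v k.
  have cf : continuous (fun v : 'rV[R]_3 => crd (H4pow k v) 1).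
    move=> v; apply: (@continuous_comp _ _ _ (H4pow k) (fun M => crd M 1)).
      by apply: zpow_continuous; [exact: Hmap_continuous|exact: Hinv_continuous].
    exact: crd_continuous.
  have g0 : 0 < 16 / 100 :> R by lra.
  have /cvgrPdist_lt/(_ _ g0) := cf x.
  by apply: filterS => v h Iv; exact: gmap_eq.
have H := @filter_forall _ 'I_N (fun i v => (Iset v -> gmap x i = gmap v i) /\
    (Iset v -> gmap x (Negz i) = gmap v (Negz i))) (nbhs x) (nbhs_filter x)
  (fun i => filterI (loc i) (loc (Negz i))).
refine (@filterS _ _ (nbhs_filter x) _ _ _ (H (nbhs_filter x))) => v h Iv n nN.
by have [h1 h2] := h (Ordinal nN); split; [exact: h1|exact: h2].
Qed.

Lemma geometric_esum_int (c r : R) : 0 <= c -> 0 < r < 1 ->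
  (\esum_(n in [set: int]) ((c * r ^+ `|n|%N)%:E) <= (2 * (c / (1 - r)))%:E)%E.
Proof.
move=> c0 /andP[r0 r1].
have pos n : 0 <= c * r ^+ n by rewrite mulr_ge0 // exprn_ge0 // ltW.
(* Used for [Posz] and [Negz], which together exhaust the integers; [Negz n] has absolute value
   [n.+1], so [n] is a lower bound in both cases. *)
have half (e : nat -> int) : injective e -> (forall n, (n <= `|e n|)%N) ->
    (\esum_(n in range e) ((c * r ^+ `|n|%N)%:E) <= (c / (1 - r))%:E)%E.
  move=> ie he; rewrite esum_image; last by move=> i j _ _; exact: ie.
  apply: (@le_trans _ _ (\esum_(n in [set: nat]) (c * r ^+ n)%:E)%E).
    by apply: le_esum => n _; rewrite lee_fin ler_wpM2l // ler_wiXn2l ?ltW.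
  rewrite -nneseries_esumT; last by move=> n; rewrite lee_fin.
  apply: lime_le; first by apply: is_cvg_nneseries => n _ _; rewrite lee_fin.
  apply: nearW => n; rewrite sumEFin lee_fin.
  by apply: (geometric_le_lim n c0 r0); rewrite ger0_norm // ltW.
rewrite (esumID (range Posz)); last by move=> n _; rewrite lee_fin.
rewrite !setTI; have -> : ~` range Posz = range Negz.
  apply/seteqP; split=> [[n|n] h|_ [n _ <-] [m _ //]]; last by exists n.
  by case: h; exists n.
rewrite mulr_natl mulr2n EFinD; apply: leeD; apply: half => //; first by move=> i j [].
by move=> i j [].
Qed.

(** Write 1/2 = 3/4 * 2/3. The words differ only where the index has absolute value at least [N], so
    the powers of 3/4 give the decay while those of 2/3 remain summable; 6 is 2 / (1 - 2/3). *)
Lemma Sdist_le (l l' : Sigma2) N :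
  (forall n : nat, (n < N)%N -> l n = l' n /\ l (Negz n) = l' (Negz n)) ->
  (@Sdist R l l' <= (6 * (3 / 4) ^+ N)%:E)%E.
Proof.
move=> h.
have r01 : 0 < (2 / 3 : R) < 1 by apply/andP; split; lra.
have q0 : 0 <= (3 / 4 : R) by lra.
have q1 : (3 / 4 : R) <= 1 by lra.
have hN (n : int) : l n != l' n -> (N <= `|n|)%N.
  case: n => n /eqP ne; rewrite leqNgt; apply/negP => nN; apply: ne.
    by have [] := h n nN.
  by have [] := h n (ltnW nN).
have term_le (n : int) : ((l n != l' n)%:R / 2 ^+ `|n|%N : R) <=
    (3 / 4) ^+ N * (2 / 3) ^+ `|n|%N.
  have [ne|_] := boolP (l n != l' n); last first.
    by rewrite mul0r mulr_ge0 ?exprn_ge0 //; lra.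
  apply: (@le_trans _ _ ((3 / 4) ^+ `|n|%N * (2 / 3) ^+ `|n|%N)).
    by rewrite -exprMn (_ : 3 / 4 * (2 / 3) = 2^-1) ?exprVn ?mul1r //; field.
  by rewrite ler_wpM2r ?exprn_ge0 ?ler_wiXn2l ?hN //; lra.
apply: (@le_trans _ _ (\esum_(n in [set: int])
    (((3 / 4) ^+ N * (2 / 3) ^+ `|n|%N)%:E : \bar R))%E).
  by apply: le_esum => n _; rewrite lee_fin.
apply: le_trans (geometric_esum_int _ _ _ r01) _; first by rewrite exprn_ge0.
rewrite lee_fin (_ : 1 - 2 / 3 = 3^-1) ?invrK; last by field.
by move: (_ ^+ N) => c; rewrite mulrCA mulrC -natrM.
Qed.

Lemma gmap_continuous_at x (e : R) : Iset x -> 0 < e -> exists2 d : R, 0 < d &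
  forall y : 'rV[R]_3, Iset y -> `|x - y| < d -> (Sdist (gmap x) (gmap y) < e%:E)%E.
Proof.
move=> Ix e0.
have [N hN] : exists N, 6 * (3 / 4) ^+ N < e.
  have e6 : 0 < e / 6 by rewrite divr_gt0.
  have q1 : `|3 / 4 : R| < 1 by rewrite ger0_norm; lra.
  have /cvgrPdist_lt/(_ _ e6)[N _ /(_ N (leqnn N))] := cvg_expr q1.
  rewrite sub0r normrN ger0_norm; last by rewrite exprn_ge0 //; lra.
  by rewrite ltr_pdivlMr // mulrC; exists N.
have /nbhs_ballP[d d0 hd] := gmap_locally_eq x N Ix.
exists d => // y Iy xy; apply: le_lt_trans (Sdist_le _ _ N _) _; last by rewrite lte_fin.
by apply: hd => //; rewrite -ball_normE.
Qed.

(** Here [v] is the x1 of the preceding point. Substituting the recursion for [x0] brings the same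
    near-cancellation in the stable coordinate as in [scoord_bound]. *)
Lemma mem_affine_cube (cy c x0 y0 z0 v : R) : 0 < c -> cy - c <= y0 <= cy + c ->
  in_xbox x0 -> in_zbox z0 -> -(908 / 1000) <= v <= 908 / 1000 ->
  x0 = henon_step z0 v ->
  cube 2 1 (aff (center R cy) (frame R c) (vec3 [:: x0; y0; z0])).
Proof.
rewrite /in_xbox /in_zbox => c0 hy hx hz hv ex.
have k0 : 0 < 57 / 4000 :> R by clear; lra.
apply/cube_coordP.
have [-> -> ->] := affE R cy c (vec3 [:: x0; y0; z0]) (lt0r_neq0 c0).
rewrite !crdE //= !ler_pdivlMr // !ler_pdivrMr //; split.
- by clear - hy; lra.
- by clear - hx hz; lra.
- have : (z0 - 882 / 1000) * (1057 / 1000 - z0) >= 0 by clear - hz; apply: mulr_ge0; lra.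
  have := sqr_ge0 (z0 - 975 / 1000).
  by move: ex hz hv; rewrite /henon_step; clear => ex hz hv h1 h2; apply/andP; split; lra.
Qed.

Lemma itinerary_realized (l : Sigma2) : exists2 x : 'rV[R]_3, Iset x & gmap x = l.
Proof.
have [u [w hu]] := itinerary_orbit R l.
pose P k : 'rV[R]_3 := vec3 [:: (u k).1.1; (u k).1.2; (u k).2].
have PS k : P (k + 1) = H4 (P k).
  have [_ _ ew ey [ez _]] := hu k; have [_ _ _ _ [_ ex]] := hu (k + 1).
  by rewrite H4E /P !crdE //= -ez -ew -ey ex addrK.
have PE k : H4pow k (P 0) = P k by rewrite H4powE -(zpow_unique _ _ _ H4K P PS).
have w_le k : -(908 / 1000) <= w k <= 908 / 1000.
  by have [_ + _ _ _] := hu k; rewrite /in_wbox; case: (l k); rewrite ?mulN1r ?mul1r; lra.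
have Pmem k : if l k then bset (P k) else aset (P k).
  have [[hx hy hz] hw ew _ [_ ex]] := hu k.
  have wk := w_le (k - 1).
  have y2 : (u k).1.2 ^+ 2 = 176 / 100 - w k - 1 / 10 * (u k).2.
    by rewrite ew /henon_step; ring.
  move: hw hz hy y2; rewrite /in_wbox /in_zbox /in_ybox.
  case: (l k); rewrite ?mulN1r ?mul1r => hw hz hy y2.
    apply/bset_cube; apply: (mem_affine_cube _ _ _ _ _ _ _ _ hx hz wk ex); rewrite /dec.
      by apply: divr_gt0; rewrite ltr0n.
    (* The sign of [w k] selects the set: a negative one gives y^2 >= 1.76 + 0.252 - 0.1057 >
       1.38^2, right of the gap. In the other case y^2 <= 1.76 - 0.252 - 0.0882 < 1.2^2, left of
       it. *)
    have y_ge : 138 / 100 <= (u k).1.2.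
      by apply: le_of_sqr_le; [clear - hy; lra|rewrite y2; clear - hw hz; lra].
    by clear - hy y_ge; apply/andP; split; lra.
  apply/aset_cube; apply: (mem_affine_cube _ _ _ _ _ _ _ _ hx hz wk ex); rewrite /dec.
    by apply: divr_gt0; rewrite ltr0n.
  have y_le : (u k).1.2 <= 120 / 100.
    by apply: le_of_sqr_le; [clear; lra|rewrite y2; clear - hw hz; lra].
  by clear - hy y_le; apply/andP; split; lra.
exists (P 0).
  apply/Iset_H4pow => k; rewrite PE; have := Pmem k.
  by case: (l k) => h; [right|left].
apply: funext => k; have := Pmem k; rewrite -PE.
by case: (l k) => h; [exact: bset_gmap|exact: aset_gmap].
Qed.

End Itineraries.

Theorem theorem3p4 (R : realType) :
  (* N_a and N_b are h-sets in R^3 with u = 2, s = 1 *)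
  is_hset 3 2 1 (@aset R) Ca Cainv /\
  is_hset 3 2 1 (@bset R) Cb Cbinv /\
  (* the four covering relations for f = H^4 *)
  covers 3 2 1 Cainv Ca (@H4 R) /\
  covers 3 2 1 Cainv Cb (@H4 R) /\
  covers 3 2 1 Cbinv Cb (@H4 R) /\
  covers 3 2 1 Cbinv Ca (@H4 R) /\
  (* symbolic dynamics: g : I -> Sigma_2 is continuous ... *)
  (forall x : 'rV[R]_3, Iset x -> forall e : R, 0 < e -> exists2 d : R, 0 < d &
     forall y : 'rV[R]_3, Iset y -> `|x - y| < d -> (Sdist (gmap x) (gmap y) < e%:E)%E) /\
  (* ... surjective ... *)
  (forall l : Sigma2, exists2 x : 'rV[R]_3, Iset x & gmap x = l) /\
  (* ... and semi-conjugates H^4|_I to the shift *)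
  (forall x : 'rV[R]_3, Iset x -> gmap (H4 x) = sigma_shift (gmap x)).
Proof.
have d0 p q : dec p.+1 q.+1 > 0 :> R by apply: divr_gt0; rewrite ltr0n.
have a_lo : 84 / 100 <= dec 409 400 - dec 73 400 :> R by rewrite /dec; lra.
have a_hi : dec 409 400 + dec 73 400 <= 161 / 100 :> R by rewrite /dec; lra.
have b_lo : 84 / 100 <= dec 119 80 - dec 49 400 :> R by rewrite /dec; lra.
have b_hi : dec 119 80 + dec 49 400 <= 161 / 100 :> R by rewrite /dec; lra.
split; first exact: affine_is_hset _ _ _ (lt0r_neq0 (d0 _ _)).
split; first exact: affine_is_hset _ _ _ (lt0r_neq0 (d0 _ _)).
split; first exact: a_covers (d0 _ _) a_lo a_hi.
split; first exact: a_covers (d0 _ _) b_lo b_hi.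
split; first exact: b_covers (d0 _ _) b_lo b_hi.
split; first exact: b_covers (d0 _ _) a_lo a_hi.
split; first by move=> x Ix e; exact: gmap_continuous_at.
split; first exact: itinerary_realized.
by move=> x _; apply: funext => k; rewrite /sigma_shift /gmap H4pow_H4.
Qed.
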